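(* Let $\dot x=P(x,y),\ \dot y=Q(x,y)$ be a real planar polynomial differential system of degree $3$ (that is, $\max\{\deg P,\deg Q\}=3$), with $P\not\equiv 0$, $Q\not\equiv 0$ and $P,Q$ without non-constant common factor, which is quasi-homogeneous but non-homogeneous. Then, when restricted to at least one of the half-planes $\{y>0\}$ or $\{x>0\}$, the system can be transformed to one of the following three homogeneous systems (with real coefficients): $\mathcal{H}_2$: $\dot x=c_{02}y^2+c_{11}xy+c_{20}x^2,\ \ \dot y=d_{02}y^2+d_{11}xy+d_{20}x^2$, where either $c_{02}d_{20}\neq 0$; or $c_{02}=d_{20}=0$ and $c_{20}d_{02}\neq 0$; $\mathcal{H}_1$: $\dot x=c_{01}y+c_{10}x,\ \ \dot y=d_{01}y+d_{10}x$, where either $c_{01}d_{10}\neq 0$; or $d_{10}=0$ and $c_{01}c_{10}d_{01}\neq 0$; or $c_{01}=0$ and $c_{10}d_{01}d_{10}\neq 0$; $\mathcal{H}_0$: $\dot x=c_0,\ \ \dot y=d_0$, where $c_0d_0\neq 0$.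
   Context: Let $\mathbb{N}$ denote the positive integers and $\mathbb{R}_+$ the positive reals. The system $\dot x=P,\ \dot y=Q$ is quasi-homogeneous if there exist $s_1,s_2,d\in\mathbb{N}$ such that for every $\alpha\in\mathbb{R}_+$ $$P(\alpha^{s_1}x,\alpha^{s_2}y)=\alpha^{s_1+d-1}P(x,y),\qquad Q(\alpha^{s_1}x,\alpha^{s_2}y)=\alpha^{s_2+d-1}Q(x,y).$$ Then $(s_1,s_2,d)$ is called a weight vector. A weight vector $(\tilde s_1,\tilde s_2,\tilde d)$ is minimal if every other weight vector $(s_1,s_2,d)$ of the system satisfies $\tilde s_1\le s_1$, $\tilde s_2\le s_2$, $\tilde d\le d$. The system is homogeneous (of degree $d$) when it admits a weight vector with $s_1=s_2=1$, and non-homogeneous otherwise. ''Can be transformed'' means the following. After possibly a re-scaling of the variables ($x$, $y$ and $t$ each multiplied by a nonzero real constant), let $(s_1,s_2,d)$ be the minimal weight vector and perform on the half-plane the change of variables $\tilde x=x^{s_2},\ \tilde y=y^{s_1}$, followed by a re-scaling of time by a monomial. That is, there are integers $k,l\ge 0$ such that on the half-plane $$\frac{d\tilde x}{dt}=x^ky^l\,\tilde P(\tilde x,\tilde y),\qquad \frac{d\tilde y}{dt}=x^ky^l\,\tilde Q(\tilde x,\tilde y),$$ where $\tilde P,\tilde Q$ are the right-hand sides of the homogeneous system (whose variables are again written $x,y$). *)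

(* Defs.v *)
(* MathComp + multinomials; the real numbers are an arbitrary R : realType. *)
From mathcomp Require Import all_boot all_order all_algebra reals.
From mathcomp Require Import mpoly.

Set Implicit Arguments.
Unset Strict Implicit.
Unset Printing Implicit Defensive.

Import Order.TTheory GRing.Theory Num.Theory.
Local Open Scope ring_scope.

(* A planar polynomial system x' = P, y' = Q is the pair P, Q : {mpoly R[2]};
   index 0 is the variable x and index 1 is the variable y. *)
Notation varx := ('X_(0 : 'I_2)) (only parsing).
Notation vary := ('X_(1 : 'I_2)) (only parsing).

Definition ev (R : realType) (P : {mpoly R[2]}) (x y : R) : R :=
  P.@[fun i : 'I_2 => if i == 0 then x else y].

(* msize is the total degree plus one on nonzero polynomials. *)
Definition system_degree (R : realType) (P Q : {mpoly R[2]}) : nat :=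
  maxn (msize P).-1 (msize Q).-1.

Definition no_common_factor (R : realType) (P Q : {mpoly R[2]}) : Prop :=
  forall D A B : {mpoly R[2]}, P = D * A -> Q = D * B ->
    exists c : R, D = c%:MP.

(* The exponents s + d - 1 use truncated subtraction, which is harmless
   since d is positive. *)
Definition weight_vector (R : realType) (P Q : {mpoly R[2]})
    (s1 s2 d : nat) : Prop :=
  [/\ (0 < s1)%N, (0 < s2)%N, (0 < d)%N &
    forall alpha : R, 0 < alpha -> forall x y : R,
      ev P (alpha ^+ s1 * x) (alpha ^+ s2 * y)
        = alpha ^+ (s1 + d - 1) * ev P x y /\
      ev Q (alpha ^+ s1 * x) (alpha ^+ s2 * y)
        = alpha ^+ (s2 + d - 1) * ev Q x y].

Definition quasi_homogeneous (R : realType) (P Q : {mpoly R[2]}) : Prop :=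
  exists s1 s2 d : nat, weight_vector P Q s1 s2 d.

Definition homogeneous (R : realType) (P Q : {mpoly R[2]}) : Prop :=
  exists d : nat, weight_vector P Q 1 1 d.

Definition minimal_weight_vector (R : realType) (P Q : {mpoly R[2]})
    (s1 s2 d : nat) : Prop :=
  weight_vector P Q s1 s2 d /\
  forall s1' s2' d' : nat, weight_vector P Q s1' s2' d' ->
    [/\ (s1 <= s1')%N, (s2 <= s2')%N & (d <= d')%N].

(* The time derivative df/dt along the solutions of x' = P, y' = Q. *)
Definition time_deriv (R : realType) (P Q f : {mpoly R[2]}) : {mpoly R[2]} :=
  f^`M(0) * P + f^`M(1) * Q.

(* The right-hand sides in the new variables X = a x, Y = b y, T = c t:
   dX/dT = (a/c) P(X/a, Y/b) and dY/dT = (b/c) Q(X/a, Y/b). *)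
Definition rescale_rhs (R : realType) (a b k : R) (F : {mpoly R[2]}) :
    {mpoly R[2]} :=
  k *: (F \mPo [tuple a^-1 *: varx; b^-1 *: vary]).

Definition rescale_P (R : realType) (a b c : R) (P : {mpoly R[2]}) :=
  rescale_rhs a b (a / c) P.

Definition rescale_Q (R : realType) (a b c : R) (Q : {mpoly R[2]}) :=
  rescale_rhs a b (b / c) Q.

Definition half_plane_y (R : realType) (x y : R) : Prop := 0 < y.
Definition half_plane_x (R : realType) (x y : R) : Prop := 0 < x.

(* On the region H, (x, y) |-> (x^s2, y^s1) is a genuine change of variables
   (injective, hence a homeomorphism onto its image when H is a half-plane),
   and it carries x' = P, y' = Q to x' = Pt, y' = Qt up to the time factor
   x^k y^l. *)
Definition power_change_on (R : realType) (H : R -> R -> Prop)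
    (s1 s2 : nat) (P Q Pt Qt : {mpoly R[2]}) : Prop :=
  (forall x y x' y' : R, H x y -> H x' y' ->
     x ^+ s2 = x' ^+ s2 -> y ^+ s1 = y' ^+ s1 -> x = x' /\ y = y') /\
  exists k l : nat, forall x y : R, H x y ->
    ev (time_deriv P Q (varx ^+ s2)) x y
      = x ^+ k * y ^+ l * ev Pt (x ^+ s2) (y ^+ s1) /\
    ev (time_deriv P Q (vary ^+ s1)) x y
      = x ^+ k * y ^+ l * ev Qt (x ^+ s2) (y ^+ s1).

(* The region H is expressed in the rescaled variables. *)
Definition transforms_on (R : realType) (H : R -> R -> Prop)
    (P Q Pt Qt : {mpoly R[2]}) : Prop :=
  exists a b c : R, [/\ a != 0, b != 0, c != 0 &
    let P' := rescale_P a b c P in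
    let Q' := rescale_Q a b c Q in
    exists s1 s2 d : nat,
      minimal_weight_vector P' Q' s1 s2 d /\
      power_change_on H s1 s2 P' Q' Pt Qt].

Definition system_H2 (R : realType) (Pt Qt : {mpoly R[2]}) : Prop :=
  exists c02 c11 c20 d02 d11 d20 : R,
    [/\ Pt = c02 *: vary ^+ 2 + c11 *: (varx * vary) + c20 *: varx ^+ 2,
        Qt = d02 *: vary ^+ 2 + d11 *: (varx * vary) + d20 *: varx ^+ 2 &
        c02 * d20 != 0 \/ [/\ c02 = 0, d20 = 0 & c20 * d02 != 0]].

Definition system_H1 (R : realType) (Pt Qt : {mpoly R[2]}) : Prop :=
  exists c01 c10 d01 d10 : R,
    [/\ Pt = c01 *: vary + c10 *: varx,
        Qt = d01 *: vary + d10 *: varx &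
        [\/ c01 * d10 != 0,
            d10 = 0 /\ c01 * c10 * d01 != 0 |
            c01 = 0 /\ c10 * d01 * d10 != 0]].

Definition system_H0 (R : realType) (Pt Qt : {mpoly R[2]}) : Prop :=
  exists c0 d0 : R, [/\ Pt = c0%:MP, Qt = d0%:MP & c0 * d0 != 0].

(* Main.v *)
(* Attach to a monomial of P d/dx + Q d/dy the exponents (u, v) for which it is a
   constant times x^u y^v times (1/y) d/dx or (1/x) d/dy; a weight vector says
   that all these points lie on one line s1 u + s2 v = const.  Cubic degree puts
   a point on u + v = 4 and non-homogeneity puts another one below, so the line
   and hence the coprime (minimal) pair s1, s2 are determined, with s1, s2 <= 4.
   Since neither x nor y divides both P and Q, only seven lines survive for
   s2 < s1 (the others follow by exchanging x and y), and on each of them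
   X = x^s2, Y = y^s1 yields one of the three normal forms.  As s1 or s2 is odd,
   the change is injective on x > 0 or on y > 0, and no rescaling is needed. *)
Require Import Defs.
From mathcomp Require Import all_boot all_order all_algebra reals boolp.
From mathcomp Require Import mpoly.
From mathcomp Require Import zify ring.

Set Implicit Arguments.
Unset Strict Implicit.
Unset Printing Implicit Defensive.

Import Order.TTheory GRing.Theory Num.Theory.
Local Open Scope ring_scope.

(** * Coefficients and values of polynomials in two variables *)

Definition mon2 (i j : nat) : 'X_{1..2} :=
  (U_(0%R : 'I_2) *+ i + U_(1%R : 'I_2) *+ j)%MM.

Definition coef2 (R : realType) (P : {mpoly R[2]}) (i j : nat) : R :=
  P@_(mon2 i j).

(** A bare coefficient function makes scaling and the exchange of the variables act directly on
    coefficients. *)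
Definition biev (R : realType) (n : nat) (c : nat -> nat -> R) (x y : R) : R :=
  \sum_(i < n) \sum_(j < n) c i j * x ^+ i * y ^+ j.

Lemma mon2E (i j : nat) : (mon2 i j 0 = i) * (mon2 i j 1 = j).
Proof.
by rewrite /mon2 !mnmDE !mulmnE !mnm1E /=; split; lia.
Qed.

Lemma mdeg_mon2 (i j : nat) : mdeg (mon2 i j) = (i + j)%N.
Proof. by rewrite mdegD !mdegMn !mdeg1 !mul1n. Qed.

Lemma mon2_exp (m : 'X_{1..2}) : mon2 (m 0) (m 1) = m.
Proof.
apply/mnmP => k; case: (unliftP 0 k) => [k'|] ->; last by rewrite mon2E.
by rewrite (ord1 k') (_ : lift 0 0 = 1 :> 'I_2) ?mon2E //; apply/val_inj.
Qed.

Lemma mon2_eq (i j i' j' : nat) :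
  (mon2 i j == mon2 i' j') = (i == i') && (j == j').
Proof.
apply/eqP/andP => [E|[/eqP -> /eqP ->] //].
have := congr1 (fun m : 'X_{1..2} => m 0) E.
have := congr1 (fun m : 'X_{1..2} => m 1) E.
by rewrite !mon2E => -> ->.
Qed.

Lemma mpolyX_mon2 (R : realType) (i j : nat) :
  'X_[mon2 i j] = 'X_(0 : 'I_2) ^+ i * 'X_(1 : 'I_2) ^+ j :> {mpoly R[2]}.
Proof. by rewrite mpolyXD -!mpolyXn. Qed.

Lemma coef2_eq0 (R : realType) (P : {mpoly R[2]}) (n i j : nat) :
  (msize P <= n)%N -> (n <= i + j)%N -> coef2 P i j = 0.
Proof.
move=> szP ij; apply/eqP; rewrite mcoeff_eq0.
by apply: msize_mdeg_ge; rewrite mdeg_mon2 (leq_trans szP).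
Qed.

Lemma mpoly2E (R : realType) (P : {mpoly R[2]}) (n : nat) :
  (msize P <= n)%N ->
  P = \sum_(i < n) \sum_(j < n)
        coef2 P i j *: ('X_(0 : 'I_2) ^+ i * 'X_(1 : 'I_2) ^+ j).
Proof.
move=> szP; apply/mpolyP => m; rewrite -(mon2_exp m).
set a := m 0; set b := m 1; rewrite -/(coef2 P a b) linear_sum /=.
under eq_bigr => i _.
  rewrite linear_sum /=.
  under eq_bigr => j _ do
    rewrite linearZ /= -mpolyX_mon2 mcoeffX mon2_eq.
  over.
case: (ltnP a n) => an; last first.
  rewrite (coef2_eq0 szP) ?(leq_trans an) ?leq_addr //.
  rewrite big1 // => i _; rewrite big1 // => j _.
  by rewrite ltn_eqF ?mulr0 // (leq_trans (ltn_ord i)).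
case: (ltnP b n) => bn; last first.
  rewrite (coef2_eq0 szP) ?(leq_trans bn) ?leq_addl //.
  rewrite big1 // => i _; rewrite big1 // => j _.
  by rewrite andbC ltn_eqF ?mulr0 // (leq_trans (ltn_ord j)).
rewrite (bigD1 (Ordinal an)) //= (bigD1 (Ordinal bn)) //= !eqxx mulr1.
rewrite big1 ?addr0 => [|j jb]; last first.
  by rewrite -val_eqE /= in jb; rewrite (negPf jb) mulr0.
rewrite big1 ?addr0 // => i ia; rewrite big1 // => j _.
by rewrite -val_eqE /= in ia; rewrite (negPf ia) mulr0.
Qed.

Lemma evE (R : realType) :
  ((forall (P Q : {mpoly R[2]}) x y,
      ev (P + Q)%R x y = (ev P x y + ev Q x y)%R) *
   (forall (P Q : {mpoly R[2]}) x y,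
      ev (P * Q)%R x y = (ev P x y * ev Q x y)%R) *
   (forall (c : R) P x y, ev (c *: P) x y = (c * ev P x y)%R) *
   (forall n (P : {mpoly R[2]}) x y, ev (P ^+ n) x y = ev P x y ^+ n) *
   (forall c x y : R, ev c%:MP x y = c) *
   (forall x y : R, ev 'X_(0 : 'I_2) x y = x) *
   (forall x y : R, ev 'X_(1 : 'I_2) x y = y))%type.
Proof.
rewrite /ev; do !split=> *;
  by rewrite (mevalD, mevalM, mevalZ, rmorphXn, mevalC, mevalXU).
Qed.

Lemma ev_biev (R : realType) (P : {mpoly R[2]}) (n : nat) (x y : R) :
  (msize P <= n)%N -> ev P x y = biev n (coef2 P) x y.
Proof.
move=> szP; rewrite {1}(mpoly2E szP) /biev /ev linear_sum.
apply: eq_bigr => i _; rewrite linear_sum; apply: eq_bigr => j _.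
by rewrite -[LHS]/(ev _ x y) !evE mulrA.
Qed.

(** A nonzero polynomial of degree less than [n] cannot vanish at the [n] distinct points 0, ..., n
    - 1. *)
Lemma poly_eval_eq0 (R : realType) (n : nat) (c : nat -> R) :
  (forall x : R, \sum_(i < n) c i * x ^+ i = 0) ->
  forall i, (i < n)%N -> c i = 0.
Proof.
move=> c0 i ltin; pose f := \poly_(k < n) c k.
have f0 : f = 0.
  apply: (@roots_geq_poly_eq0 _ _ [seq k%:R | k <- iota 0 n]).
  - by apply/allP => x _; rewrite rootE horner_poly c0.
  - by rewrite map_inj_uniq ?iota_uniq //; apply: mulrIn; exact: oner_neq0.
  - by rewrite size_map size_iota size_poly.
by have := congr1 (fun g : {poly R} => g`_i) f0; rewrite coef_poly coef0 ltin.
Qed.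

Lemma biev_eq0 (R : realType) (n : nat) (c : nat -> nat -> R) :
  (forall x y : R, biev n c x y = 0) ->
  forall i j, (i < n)%N -> (j < n)%N -> c i j = 0.
Proof.
move=> c0 i j lin ljn.
apply: (@poly_eval_eq0 _ n (c i)) ljn => y.
pose e k := \sum_(l < n) c k l * y ^+ l.
apply: (@poly_eval_eq0 _ n e) lin => x.
rewrite -[RHS](c0 x y) /biev; apply: eq_bigr => k _.
by rewrite /e mulr_suml; apply: eq_bigr => l _; rewrite mulrAC.
Qed.

Lemma biev_scale (R : realType) (n s1 s2 : nat) (c : nat -> nat -> R)
    (t x y : R) :
  biev n c (t ^+ s1 * x) (t ^+ s2 * y) =
  biev n (fun i j => t ^+ (s1 * i + s2 * j) * c i j) x y.
Proof.
apply: eq_bigr => i _; apply: eq_bigr => j _.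
by rewrite !exprMn -!exprM exprD; ring.
Qed.

(** * Weight vectors as linear conditions on exponents *)

Definition supported_on (R : realType) (c : nat -> nat -> R)
    (s1 s2 N : nat) : Prop :=
  forall i j : nat, c i j != 0 -> (s1 * i + s2 * j)%N = N.

(** From left to right the single factor t = 2 suffices: at a nonzero coefficient it gives 2^(s1 i +
    s2 j) = 2^N, and powers of 2 determine their exponent. *)
Lemma supported_onP (R : realType) (P : {mpoly R[2]}) (s1 s2 N : nat) :
  (forall t : R, 0 < t -> forall x y : R,
     ev P (t ^+ s1 * x) (t ^+ s2 * y) = t ^+ N * ev P x y) <->
  supported_on (coef2 P) s1 s2 N.
Proof.
have E := fun x y => ev_biev x y (leqnn (msize P)).
split=> [wP i j cij|sP t _ x y]; last first.
  rewrite !E biev_scale /biev mulr_sumr; apply: eq_bigr => i _.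
  rewrite mulr_sumr; apply: eq_bigr => j _.
  have [->|/sP ->] := eqVneq (coef2 P i j) 0; first by rewrite !(mulr0, mul0r).
  by rewrite !mulrA.
have lt_ij : (i + j < msize P)%N.
  by rewrite ltnNge; apply: contraNN cij => /coef2_eq0 ->.
have /biev_eq0/(_ i j) : forall x y, biev (msize P) (fun i j =>
    ((2 : R) ^+ (s1 * i + s2 * j) - 2 ^+ N) * coef2 P i j) x y = 0.
  move=> x y; have /(_ x y) /eqP := wP 2 (ltr0n _ 2).
  rewrite !E biev_scale -subr_eq0 => /eqP <-.
  rewrite /biev mulr_sumr -sumrB; apply: eq_bigr => k _.
  rewrite mulr_sumr -sumrB; apply: eq_bigr => l _; ring.
rewrite (leq_ltn_trans (leq_addr _ _) lt_ij).
rewrite (leq_ltn_trans (leq_addl _ _) lt_ij) => /(_ isT isT) /eqP.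
rewrite mulf_eq0 (negPf cij) orbF subr_eq0 => /eqP.
by apply: ieexprIn; rewrite ?ltr0n // pnatr_eq1.
Qed.

Lemma weight_vectorP (R : realType) (P Q : {mpoly R[2]}) (s1 s2 d : nat) :
  weight_vector P Q s1 s2 d <->
  [/\ (0 < s1)%N, (0 < s2)%N, (0 < d)%N,
      supported_on (coef2 P) s1 s2 (s1 + d - 1) &
      supported_on (coef2 Q) s1 s2 (s2 + d - 1)].
Proof.
split=> [[s1_gt0 s2_gt0 d_gt0 W]|[s1_gt0 s2_gt0 d_gt0 WP WQ]]; split=> //.
- by apply/supported_onP => t t_gt0 x y; case: (W t t_gt0 x y).
- by apply/supported_onP => t t_gt0 x y; case: (W t t_gt0 x y).
by move=> t t_gt0 x y; split; move: t t_gt0 x y; apply/supported_onP.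
Qed.

(* The shifts put the monomials of P and of Q on a common line. *)
Definition field_support (R : realType) (p q : nat -> nat -> R)
    (u v : nat) : bool :=
  (0 < v)%N && (p u v.-1 != 0) || (0 < u)%N && (q u.-1 v != 0).

(** The shift v = j + 1 adds s2 to the condition for P, and u = i + 1 adds s1 to the one for Q; both
    become s1 u + s2 v = s1 + s2 + d - 1. Moving the 1 across avoids truncated subtraction. *)
Lemma field_supportP (R : realType) (P Q : {mpoly R[2]}) (s1 s2 d : nat) :
  weight_vector P Q s1 s2 d <->
  [/\ (0 < s1)%N, (0 < s2)%N, (0 < d)%N &
      forall u v, field_support (coef2 P) (coef2 Q) u v ->
        (s1 * u + s2 * v + 1 = s1 + s2 + d)%N].
Proof.
rewrite weight_vectorP; split=> [[? ? ? WP WQ]|[? ? ? W]]; split=> //.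
- by move=> u v /orP[] /andP[gt0 nz]; [have := WP _ _ nz|have := WQ _ _ nz];
    nia.
- move=> i j nz; have := W i j.+1.
  by rewrite /field_support /= nz /= => /(_ isT); lia.
- move=> i j nz; have := W i.+1 j.
  by rewrite /field_support /= nz orbT /= => /(_ isT); lia.
Qed.

(** * Monomials forced by nonvanishing and by the absence of common factors *)

Lemma mpoly2_neq0 (R : realType) (P : {mpoly R[2]}) :
  P != 0 -> exists i j, [/\ (i + j = (msize P).-1)%N & coef2 P i j != 0].
Proof.
move=> P0; exists (mlead P 0), (mlead P 1); rewrite /coef2 mon2_exp.
rewrite -mcoeff_msupp mlead_supp // -(mlead_deg P0) /=; split=> //.
by rewrite -[in RHS](mon2_exp (mlead P)) mdeg_mon2.
Qed.

Lemma dvdX0 (R : realType) (P : {mpoly R[2]}) :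
  (forall j, coef2 P 0 j = 0) -> exists A, P = 'X_(0 : 'I_2) * A.
Proof.
move=> P0; pose n := msize P.
(* Division by x lowers the first exponent by one. Expanding P over the range [n.+1] leaves exactly
   [n] terms once index 0 is split off. *)
exists (\sum_(i < n) \sum_(j < n.+1)
  coef2 P i.+1 j *: ('X_(0 : 'I_2) ^+ i * 'X_(1 : 'I_2) ^+ j)).
rewrite {1}(@mpoly2E _ P n.+1) // big_ord_recl.
rewrite big1 ?add0r => [|j _]; last first.
  by rewrite P0 scale0r.
rewrite mulr_sumr; apply: eq_bigr => i _.
rewrite mulr_sumr; apply: eq_bigr => j _.
by rewrite -scalerAr mulrA -exprS.
Qed.

Lemma dvdX1 (R : realType) (P : {mpoly R[2]}) :
  (forall i, coef2 P i 0 = 0) -> exists A, P = 'X_(1 : 'I_2) * A.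
Proof.
move=> P0; pose n := msize P.
exists (\sum_(i < n.+1) \sum_(j < n)
  coef2 P i j.+1 *: ('X_(0 : 'I_2) ^+ i * 'X_(1 : 'I_2) ^+ j)).
rewrite {1}(@mpoly2E _ P n.+1) // mulr_sumr; apply: eq_bigr => i _.
rewrite big_ord_recl P0 scale0r add0r mulr_sumr; apply: eq_bigr => j _.
by rewrite -scalerAr mulrCA -exprS.
Qed.

Lemma no_common_variable (R : realType) (P Q A B : {mpoly R[2]}) (k : 'I_2) :
  no_common_factor P Q -> P = 'X_k * A -> Q = 'X_k * B -> False.
Proof.
move=> cPQ PA QB; have [c E] := cPQ _ _ _ PA QB.
(* The values at (0, 0) and (1, 1) distinguish a variable from a constant. *)
have := congr1 (meval (fun=> 1)) E; have := congr1 (meval (fun=> 0)) E.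
by rewrite !mevalXU !mevalC => <- /eqP; rewrite oner_eq0.
Qed.

Lemma no_common_X0 (R : realType) (P Q : {mpoly R[2]}) :
  no_common_factor P Q -> exists j, coef2 P 0 j != 0 \/ coef2 Q 0 j != 0.
Proof.
move=> cPQ; apply: contrapT => N.
have [A PA] : exists A, P = 'X_(0 : 'I_2) * A.
  by apply: dvdX0 => j; apply: contrapT => /eqP nz; apply: N; exists j; left.
have [B QB] : exists B, Q = 'X_(0 : 'I_2) * B.
  by apply: dvdX0 => j; apply: contrapT => /eqP nz; apply: N; exists j; right.
exact: no_common_variable PA QB.
Qed.

Lemma no_common_X1 (R : realType) (P Q : {mpoly R[2]}) :
  no_common_factor P Q -> exists i, coef2 P i 0 != 0 \/ coef2 Q i 0 != 0.
Proof.
move=> cPQ; apply: contrapT => N.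
have [A PA] : exists A, P = 'X_(1 : 'I_2) * A.
  by apply: dvdX1 => i; apply: contrapT => /eqP nz; apply: N; exists i; left.
have [B QB] : exists B, Q = 'X_(1 : 'I_2) * B.
  by apply: dvdX1 => i; apply: contrapT => /eqP nz; apply: N; exists i; right.
exact: no_common_variable PA QB.
Qed.

(** * Coprime and minimal weight vectors *)

Lemma weight_vector_coprime (R : realType) (P Q : {mpoly R[2]}) :
  P != 0 -> quasi_homogeneous P Q ->
  exists s1 s2 d, weight_vector P Q s1 s2 d /\ coprime s1 s2.
Proof.
move=> /mpoly2_neq0[i [j [_ nz]]] [s1 [s2 [d]]].
case/field_supportP=> s1_gt0 s2_gt0 d_gt0 W.
have S0 : field_support (coef2 P) (coef2 Q) i j.+1.
  by rewrite /field_support /= nz.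
have g_gt0 : (0 < gcdn s1 s2)%N by rewrite gcdn_gt0 s1_gt0.
have := dvdn_gcdl s1 s2; have := dvdn_gcdr s1 s2.
move: (erefl (gcdn s1 s2)) g_gt0; move: {2 3 4 5}(gcdn s1 s2) => g.
move=> Eg g_gt0 /dvdnP[b Eb] /dvdnP[a Ea].
have cab : coprime a b.
  by rewrite /coprime -(eqn_pmul2r g_gt0) muln_gcdl -Ea -Eb mul1n Eg.
have W0 := W _ _ S0.
(* Division by [g] keeps the line through the points. It is d - 1, not d, that gets divided, so the
   new degree is read off from the point (i, j + 1). *)
exists a, b, (a * i + b * j.+1 + 1 - (a + b))%N; split=> //.
(* Since d > 0, the truncated subtraction in the new degree is exact and that degree is positive. *)
have le_ab : (a + b <= a * i + b * j.+1)%N.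
  by rewrite -(leq_pmul2r g_gt0); move: W0 d_gt0; rewrite Ea Eb; lia.
apply/field_supportP; split; [nia|nia|lia|] => u v /W Wuv.
suff : (a * u + b * v = a * i + b * j.+1)%N by lia.
by apply/eqP; rewrite -(eqn_pmul2r g_gt0); move: W0 Wuv; rewrite Ea Eb; lia.
Qed.

(* The two points determine the ratio s1 : s2, because their difference is not
   orthogonal to (1, 1); so every weight vector is a multiple of the coprime
   one. *)
Lemma coprime_weight_vector_minimal (R : realType) (P Q : {mpoly R[2]})
    (s1 s2 d u v u' v' : nat) :
  field_support (coef2 P) (coef2 Q) u v ->
  field_support (coef2 P) (coef2 Q) u' v' -> (u' + v' < u + v)%N ->
  weight_vector P Q s1 s2 d -> coprime s1 s2 ->
  minimal_weight_vector P Q s1 s2 d.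
Proof.
move=> S S' lt W cop; split=> // a b e.
case/field_supportP: W => s1_gt0 s2_gt0 d_gt0 W.
case/field_supportP=> a_gt0 b_gt0 e_gt0 W'.
have [E1 E2] := (W _ _ S, W _ _ S'); have [F1 F2] := (W' _ _ S, W' _ _ S').
have E : (s1 * b = s2 * a)%N.
  apply: contrapT => N; suff : u = u' /\ v = v' by lia.
  suff [] : (u%:Z - u'%:Z = 0)%R /\ (v%:Z - v'%:Z = 0)%R by lia.
  have N' : (s1%:Z * b%:Z - s2%:Z * a%:Z != 0)%R by lia.
  have G : (s1%:Z * (u%:Z - u'%:Z) + s2%:Z * (v%:Z - v'%:Z) = 0)%R by lia.
  have G' : (a%:Z * (u%:Z - u'%:Z) + b%:Z * (v%:Z - v'%:Z) = 0)%R by lia.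
  (* Cramer's rule: the determinant s1 b - s2 a, assumed nonzero, annihilates both coordinate
     differences. *)
  by split; apply: (mulfI N'); [transitivity
       (b%:Z * (s1%:Z * (u%:Z - u'%:Z) + s2%:Z * (v%:Z - v'%:Z)) -
        s2%:Z * (a%:Z * (u%:Z - u'%:Z) + b%:Z * (v%:Z - v'%:Z)))%R |
     transitivity
       (s1%:Z * (a%:Z * (u%:Z - u'%:Z) + b%:Z * (v%:Z - v'%:Z)) -
        a%:Z * (s1%:Z * (u%:Z - u'%:Z) + s2%:Z * (v%:Z - v'%:Z)))%R];
    first [ring | rewrite G G'; ring].
have /dvdnP[t Et] : (s1 %| a)%N by rewrite -(Gauss_dvdr _ cop) -E dvdn_mulr.
have Eb : (b = t * s2)%N.
  by apply/eqP; rewrite -(eqn_pmul2l s1_gt0) E Et; apply/eqP; ring.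
have t_gt0 : (0 < t)%N by lia.
rewrite Et Eb; split; rewrite ?leq_pmull //.
have {}E1 : (t * (s1 * u + s2 * v + 1) = t * (s1 + s2 + d))%N by rewrite E1.
(* That is, e - 1 = t (d - 1), whence d <= e because t >= 1. *)
have Ed : (t * d + 1 = e + t)%N by move: F1 E1; rewrite Et Eb; clear; lia.
by move: t_gt0 d_gt0 Ed; clear; nia.
Qed.

(** * The change of variables on a half-plane *)

Lemma ev_time_deriv_X0 (R : realType) (P Q : {mpoly R[2]}) (s : nat) (x y : R) :
  ev (time_deriv P Q ('X_(0 : 'I_2) ^+ s)) x y = s%:R * x ^+ s.-1 * ev P x y.
Proof.
rewrite /time_deriv mpolyXn !mderivX.
have -> : (U_(0%R : 'I_2) *+ s - U_(0%R : 'I_2))%MM = mon2 s.-1 0.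
  apply/mnmP => k; rewrite /mon2 mnmBE mnmDE !mulmnE !mnm1E; lia.
rewrite mpolyX_mon2 !mulmnE !mnm1E /= !evE; ring.
Qed.

Lemma ev_time_deriv_X1 (R : realType) (P Q : {mpoly R[2]}) (s : nat) (x y : R) :
  ev (time_deriv P Q ('X_(1 : 'I_2) ^+ s)) x y = s%:R * y ^+ s.-1 * ev Q x y.
Proof.
rewrite /time_deriv mpolyXn !mderivX.
have -> : (U_(1%R : 'I_2) *+ s - U_(1%R : 'I_2))%MM = mon2 0 s.-1.
  apply/mnmP => k; rewrite /mon2 mnmBE mnmDE !mulmnE !mnm1E; lia.
rewrite mpolyX_mon2 !mulmnE !mnm1E /= !evE; ring.
Qed.

Lemma rescale_rhs1 (R : realType) (F : {mpoly R[2]}) : rescale_rhs 1 1 1 F = F.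
Proof.
rewrite /rescale_rhs scale1r -[RHS]comp_mpoly_id; congr (_ \mPo _).
apply: eq_from_tnth => k; rewrite tnth_mktuple invr1 !scale1r.
by case: k => [[|[|//]] lk] /=; rewrite (tnth_nth 0) /=;
  congr 'X_(_); apply/val_inj.
Qed.

(** For x >= 0, oddness forces y >= 0 and injectivity on nonnegative reals applies; negation covers
    x < 0. *)
Lemma odd_exp_inj (R : realType) (n : nat) :
  odd n -> injective (fun x : R => x ^+ n).
Proof.
move=> on; have n_gt0 : (0 < n)%N by case: n on.
have pos (x y : R) : 0 <= x -> x ^+ n = y ^+ n -> x = y.
  move=> x0 E; have y0 : 0 <= y by rewrite -(exprn_odd_ge0 _ on) -E exprn_ge0.
  by apply: (pexpIrn n_gt0).
move=> x y /= E; have [/pos|/ltW x0] := leP 0 x; first exact.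
apply: oppr_inj; apply: pos; first by rewrite oppr_ge0.
by rewrite exprNn E -exprNn.
Qed.

Lemma transforms_on_half_plane (R : realType) (P Q Pt Qt : {mpoly R[2]})
    (s1 s2 d k l : nat) :
  minimal_weight_vector P Q s1 s2 d -> coprime s1 s2 ->
  (forall x y : R,
     s2%:R * x ^+ s2.-1 * ev P x y
       = x ^+ k * y ^+ l * ev Pt (x ^+ s2) (y ^+ s1) /\
     s1%:R * y ^+ s1.-1 * ev Q x y
       = x ^+ k * y ^+ l * ev Qt (x ^+ s2) (y ^+ s1)) ->
  exists H : R -> R -> Prop,
    (H = @half_plane_y R \/ H = @half_plane_x R) /\ transforms_on H P Q Pt Qt.
Proof.
move=> minW cop E; have [[s1_gt0 s2_gt0 _ _] _] := minW.
suff [H HH inj] : exists2 H : R -> R -> Prop,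
    H = @half_plane_y R \/ H = @half_plane_x R &
    forall x y x' y' : R, H x y -> H x' y' ->
      x ^+ s2 = x' ^+ s2 -> y ^+ s1 = y' ^+ s1 -> x = x' /\ y = y'.
  exists H; split=> //; exists 1, 1, 1; rewrite oner_eq0; split=> //=.
  rewrite /rescale_P /rescale_Q divr1 !rescale_rhs1.
  exists s1, s2, d; split=> //; split=> //; exists k, l => x y _.
  by rewrite ev_time_deriv_X0 ev_time_deriv_X1.
have pinj n (x y : R) : (0 < n)%N -> 0 < x -> 0 < y -> x ^+ n = y ^+ n -> x = y.
  by move=> n_gt0 /ltW x0 /ltW y0; apply: (pexpIrn n_gt0).
(* An odd power is injective on the whole line, so only the other variable needs a fixed sign. *)
have [os2|es2] := boolP (odd s2).
  exists (@half_plane_y R); first by left.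
  move=> x y x' y' y0 y0' Ex Ey; split; first exact: (odd_exp_inj os2).
  exact: (pinj s1).
have os1 : odd s1.
  apply: contraLR cop => es1; rewrite /coprime gtn_eqF //.
  by apply: (@dvdn_leq 2); rewrite ?gcdn_gt0 ?s1_gt0 // dvdn_gcd !dvdn2 es1.
exists (@half_plane_x R); first by right.
move=> x y x' y' x0 x0' Ex Ey; split; last exact: (odd_exp_inj os1).
exact: (pinj s2).
Qed.

(** * The possible weight vectors with s2 < s1 *)

Lemma cubic_weights (s1 s2 d u v u' v' u0 v0 u1 v1 : nat) :
  (0 < s2 < s1)%N -> (0 < d)%N -> coprime s1 s2 ->
  let on_line a b := (s1 * a + s2 * b + 1 = s1 + s2 + d)%N in
  on_line u v -> (u + v = 4)%N -> on_line u' v' -> (u' + v' < 4)%N ->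
  on_line u0 v0 -> (u0 <= 1)%N -> (u0 + v0 <= 4)%N ->
  on_line u1 v1 -> (v1 <= 1)%N -> (u1 + v1 <= 4)%N ->
  (s1, s2, d) \in [:: (2, 1, 2); (3, 1, 1); (3, 2, 4); (4, 3, 6);
                      (2, 1, 3); (3, 1, 3); (3, 2, 5)]%N.
Proof.
move=> /andP[s2_gt0 lt_s] d_gt0 cop /= E uv E' uv' E0 u0_le uv0 E1 v1_le uv1.
(* On a line with s1 > s2 > 0, a smaller sum u + v means a smaller v. *)
have lt_v : (v' < v)%N by clear E0 E1; nia.
(* By coprimality s1 divides v - v', which is positive and at most 4. *)
have s1_le4 : (s1 <= 4)%N.
  have /dvdn_leq : (s1 %| v - v')%N.
    rewrite -(Gauss_dvdr _ cop); apply/dvdnP; exists (u' - u)%N.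
    by clear E0 E1; nia.
  by rewrite subn_gt0 lt_v => /(_ isT); lia.
have {lt_v E' uv' u' v'} v_le : (v <= 4)%N by lia.
have {uv} Eu : u = (4 - v)%N by lia.
have {E} Ed : d = (s1 * u + s2 * v + 1 - s1 - s2)%N by lia.
subst u d.
(* Finitely many triples s1, s2, v remain, and they determine d; off the list the hypotheses are
   contradictory. *)
case: s1 s1_le4 => [|[|[|[|[|//]]]]] _ in s2_gt0 lt_s d_gt0 cop E0 E1 *;
  case: s2 => [|[|[|[|s2]]]] // in s2_gt0 lt_s d_gt0 cop E0 E1 *;
  case: v v_le => [|[|[|[|[|//]]]]] _ // in d_gt0 E0 E1 *; exfalso; lia.
Qed.

(** * Reduction to the normal forms *)

Definition canonical_system (R : realType) (Pt Qt : {mpoly R[2]}) : Prop :=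
  [\/ system_H2 Pt Qt, system_H1 Pt Qt | system_H0 Pt Qt].

(** The left-hand sides are the derivatives of [x ^+ s2] and [y ^+ s1] along x' = f, y' = g. Taking
    f and g as functions lets the variables be exchanged freely. *)
Definition power_reducible (R : realType) (s1 s2 : nat) (f g : R -> R -> R) :
    Prop :=
  exists (Pt Qt : {mpoly R[2]}) (k l : nat), canonical_system Pt Qt /\
    forall x y : R,
      s2%:R * x ^+ s2.-1 * f x y
        = x ^+ k * y ^+ l * ev Pt (x ^+ s2) (y ^+ s1) /\
      s1%:R * y ^+ s1.-1 * g x y
        = x ^+ k * y ^+ l * ev Qt (x ^+ s2) (y ^+ s1).

Lemma power_reducible_H2 (R : realType) (s1 s2 k l : nat) (f g : R -> R -> R)
    (c02 c11 c20 d02 d11 d20 : R) :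
  (forall x y : R,
     s2%:R * x ^+ s2.-1 * f x y = x ^+ k * y ^+ l *
       (c02 * (y ^+ s1) ^+ 2 + c11 * (x ^+ s2 * y ^+ s1) +
        c20 * (x ^+ s2) ^+ 2) /\
     s1%:R * y ^+ s1.-1 * g x y = x ^+ k * y ^+ l *
       (d02 * (y ^+ s1) ^+ 2 + d11 * (x ^+ s2 * y ^+ s1) +
        d20 * (x ^+ s2) ^+ 2)) ->
  c02 * d20 != 0 \/ [/\ c02 = 0, d20 = 0 & c20 * d02 != 0] ->
  power_reducible s1 s2 f g.
Proof.
move=> E nz.
exists (c02 *: 'X_(1 : 'I_2) ^+ 2 + c11 *: ('X_(0 : 'I_2) * 'X_(1 : 'I_2)) +
        c20 *: 'X_(0 : 'I_2) ^+ 2),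
       (d02 *: 'X_(1 : 'I_2) ^+ 2 + d11 *: ('X_(0 : 'I_2) * 'X_(1 : 'I_2)) +
        d20 *: 'X_(0 : 'I_2) ^+ 2), k, l.
split; last by move=> x y; rewrite !evE.
by apply: Or31; exists c02, c11, c20, d02, d11, d20.
Qed.

Lemma power_reducible_H1 (R : realType) (s1 s2 k l : nat) (f g : R -> R -> R)
    (c01 c10 d01 d10 : R) :
  (forall x y : R,
     s2%:R * x ^+ s2.-1 * f x y
       = x ^+ k * y ^+ l * (c01 * y ^+ s1 + c10 * x ^+ s2) /\
     s1%:R * y ^+ s1.-1 * g x y
       = x ^+ k * y ^+ l * (d01 * y ^+ s1 + d10 * x ^+ s2)) ->
  [\/ c01 * d10 != 0, d10 = 0 /\ c01 * c10 * d01 != 0 |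
      c01 = 0 /\ c10 * d01 * d10 != 0] ->
  power_reducible s1 s2 f g.
Proof.
move=> E nz.
exists (c01 *: 'X_(1 : 'I_2) + c10 *: 'X_(0 : 'I_2)),
       (d01 *: 'X_(1 : 'I_2) + d10 *: 'X_(0 : 'I_2)), k, l.
split; last by move=> x y; rewrite !evE.
by apply: Or32; exists c01, c10, d01, d10.
Qed.

Lemma power_reducible_H0 (R : realType) (s1 s2 k l : nat) (f g : R -> R -> R)
    (c0 d0 : R) :
  (forall x y : R,
     s2%:R * x ^+ s2.-1 * f x y = x ^+ k * y ^+ l * c0 /\
     s1%:R * y ^+ s1.-1 * g x y = x ^+ k * y ^+ l * d0) ->
  c0 * d0 != 0 -> power_reducible s1 s2 f g.
Proof.
move=> E nz; exists c0%:MP, d0%:MP, k, l.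
split; last by move=> x y; rewrite !evE.
by apply: Or33; exists c0, d0.
Qed.

(** Exchanging x and y preserves each family of normal forms; in the linear one it interchanges the
    two triangular alternatives. This reduces s1 < s2 to s2 < s1. *)
Lemma power_reducible_swap (R : realType) (s1 s2 : nat) (f g : R -> R -> R) :
  power_reducible s2 s1 (fun x y => g y x) (fun x y => f y x) ->
  power_reducible s1 s2 f g.
Proof.
case=> Pt [Qt [k [l [+ E]]]]; case.
- case=> c02 [c11 [c20 [d02 [d11 [d20 [Ep Eq nz]]]]]].
  apply: (@power_reducible_H2 _ _ _ l k _ _ d20 d11 d02 c20 c11 c02).
    move=> x y; have [Ex Ey] := E y x; move: Ex Ey; rewrite Ep Eq !evE.
    by move=> -> ->; split; ring.
  by case: nz => [nz|[-> -> nz]]; [left|right; split]; rewrite // mulrC.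
- case=> c01 [c10 [d01 [d10 [Ep Eq nz]]]].
  apply: (@power_reducible_H1 _ _ _ l k _ _ d10 d01 c10 c01).
    move=> x y; have [Ex Ey] := E y x; move: Ex Ey; rewrite Ep Eq !evE.
    by move=> -> ->; split; ring.
  case: nz => [nz|[z nz]|[z nz]].
  - by apply: Or31; rewrite mulrC.
  - by apply: Or33; split=> //; rewrite mulrC (mulrC d01) mulrA.
  - by apply: Or32; split=> //; rewrite mulrC (mulrC d10) mulrA.
case=> c0 [d0 [Ep Eq nz]].
apply: (@power_reducible_H0 _ _ _ l k _ _ d0 c0); last by rewrite mulrC.
move=> x y; have [Ex Ey] := E y x; move: Ex Ey; rewrite Ep Eq !evE.
by move=> -> ->; split; ring.
Qed.

Lemma biev_swap (R : realType) (n : nat) (c : nat -> nat -> R) (x y : R) :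
  biev n (fun i j => c j i) x y = biev n c y x.
Proof.
rewrite /biev exchange_big; apply: eq_bigr => i _; apply: eq_bigr => j _.
by rewrite mulrAC.
Qed.

(** With concrete weights the test computes, so the double sum unfolds to the few monomials on the
    line. *)
Lemma biev_supported (R : realType) (n s1 s2 N : nat) (c : nat -> nat -> R)
    (x y : R) :
  supported_on c s1 s2 N -> (forall i j, c i j != 0 -> (i + j < n)%N) ->
  biev n c x y = \sum_(i < n) \sum_(j < n)
    if (s1 * i + s2 * j == N)%N && (i + j < n)%N then c i j * x ^+ i * y ^+ j
    else 0.
Proof.
move=> sc dc; apply: eq_bigr => i _; apply: eq_bigr => j _.
have [->|nz] := eqVneq (c i j) 0; first by rewrite !mul0r if_same.
by rewrite (sc _ _ nz) eqxx dc.
Qed.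

(** The nonzero coefficients demanded by each normal form come from the point on u + v = 4, from P
    and Q being nonzero, and from x and y not dividing both. *)
Lemma cubic_power_reducible (R : realType) (p q : nat -> nat -> R)
    (s1 s2 d : nat) :
  (0 < s2 < s1)%N -> (0 < d)%N -> coprime s1 s2 ->
  supported_on p s1 s2 (s1 + d - 1) -> supported_on q s1 s2 (s2 + d - 1) ->
  (forall i j, p i j != 0 -> (i + j < 4)%N) ->
  (forall i j, q i j != 0 -> (i + j < 4)%N) ->
  (exists i j, p i j != 0) -> (exists i j, q i j != 0) ->
  (exists u v, field_support p q u v /\ (u + v = 4)%N) ->
  (exists u v, field_support p q u v /\ (u + v < 4)%N) ->
  (exists j, p 0%N j != 0 \/ q 0%N j != 0) ->
  (exists i, p i 0%N != 0 \/ q i 0%N != 0) ->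
  power_reducible s1 s2 (biev 4 p) (biev 4 q).
Proof.
move=> lt_s d_gt0 cop sp sq dp dq p0 q0 [u [v [S uv]]] [u' [v' [S' uv']]] x0 y0.
have L a b : field_support p q a b -> (s1 * a + s2 * b + 1 = s1 + s2 + d)%N.
  by case/orP=> /andP[gt0 nz]; [have := sp _ _ nz|have := sq _ _ nz]; nia.
(* A monomial free of x has a = 0 if it is in P and a = 1 if it is in Q. *)
have [a0 [b0 [E0 a0_le ab0]]] : exists a b,
    [/\ s1 * a + s2 * b + 1 = s1 + s2 + d, a <= 1 & a + b <= 4]%N.
  case: x0 => j [] nz.
    by have := sp _ _ nz; have := dp _ _ nz; exists 0%N, j.+1; split; lia.
  by have := sq _ _ nz; have := dq _ _ nz; exists 1%N, j; split; lia.
have [a1 [b1 [E1 b1_le ab1]]] : exists a b,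
    [/\ s1 * a + s2 * b + 1 = s1 + s2 + d, b <= 1 & a + b <= 4]%N.
  case: y0 => i [] nz.
    by have := sp _ _ nz; have := dp _ _ nz; exists i, 1%N; split; lia.
  by have := sq _ _ nz; have := dq _ _ nz; exists i.+1, 0%N; split; lia.
have := cubic_weights lt_s d_gt0 cop (L _ _ S) uv (L _ _ S') uv'
  E0 a0_le ab0 E1 b1_le ab1.
have Ep := biev_supported _ _ sp dp; have Eq := biev_supported _ _ sq dq.
have {L S' u' v' uv'} Suv := L _ _ S.
(* The point (0, 4) can only come from the monomial y^3 of P. *)
have {S} p03 : u = 0%N -> p 0%N 3%N != 0.
  move=> u0; have v4 : v = 4%N by lia.
  by move: S; rewrite u0 v4 /field_support orbF.
clear lt_s d_gt0 cop E0 a0_le ab0 E1 b1_le ab1.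
rewrite !inE => /or3P[|| /or3P[|| /or3P[||]]] /eqP[? ? ?]; subst s1 s2 d.
(* P = p03 y^3 + p11 x y and Q = q02 y^2 + q10 x, with X = x, Y = y^2. *)
- have {}p03 := p03 ltac:(lia).
  have q10 : q 1%N 0%N != 0.
    case: y0 => i [] nz; first by have := sp _ _ nz; lia.
    have i1 : i = 1%N by have := sq _ _ nz; lia.
    by rewrite i1 in nz.
  apply: (@power_reducible_H1 _ _ _ 0 1 _ _
    (p 0%N 3%N) (p 1%N 1%N) (2 * q 0%N 2%N) (2 * q 1%N 0%N)).
    move=> x y; rewrite Ep Eq !big_ord_recl !big_ord0 /bump /=; split; ring.
  by apply: Or31; rewrite !mulf_neq0 ?pnatr_eq0.
(* P = p03 y^3 + p10 x and Q = q01 y, with X = x, Y = y^3. *)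
- have {}p03 := p03 ltac:(lia).
  have p10 : p 1%N 0%N != 0.
    case: y0 => i [] nz; last by have := sq _ _ nz; lia.
    have i1 : i = 1%N by have := sp _ _ nz; lia.
    by rewrite i1 in nz.
  have q01 : q 0%N 1%N != 0.
    case: q0 => i [j nz].
    have [i0 j1] : i = 0%N /\ j = 1%N by have := sq _ _ nz; lia.
    by rewrite i0 j1 in nz.
  apply: (@power_reducible_H1 _ _ _ 0 0 _ _
    (p 0%N 3%N) (p 1%N 0%N) (3 * q 0%N 1%N) 0).
    move=> x y; rewrite Ep Eq !big_ord_recl !big_ord0 /bump /=; split; ring.
  by apply: Or32; split=> //; rewrite !mulf_neq0 ?pnatr_eq0.
(* P = p03 y^3 + p20 x^2 and Q = q11 x y, with X = x^2, Y = y^3. *)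
- have {}p03 := p03 ltac:(lia).
  have p20 : p 2%N 0%N != 0.
    case: y0 => i [] nz; last by have := sq _ _ nz; lia.
    have i2 : i = 2%N by have := sp _ _ nz; lia.
    by rewrite i2 in nz.
  have q11 : q 1%N 1%N != 0.
    case: q0 => i [j nz].
    have [i1 j1] : i = 1%N /\ j = 1%N by have := sq _ _ nz; lia.
    by rewrite i1 j1 in nz.
  apply: (@power_reducible_H1 _ _ _ 1 0 _ _
    (2 * p 0%N 3%N) (2 * p 2%N 0%N) (3 * q 1%N 1%N) 0).
    move=> x y; rewrite Ep Eq !big_ord_recl !big_ord0 /bump /=; split; ring.
  by apply: Or32; split=> //; rewrite !mulf_neq0 ?pnatr_eq0.
(* P = p03 y^3 and Q = q20 x^2, with X = x^3, Y = y^4. *)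
- have {}p03 := p03 ltac:(lia).
  have q20 : q 2%N 0%N != 0.
    case: q0 => i [j nz].
    have [i2 j0] : i = 2%N /\ j = 0%N by have := sq _ _ nz; lia.
    by rewrite i2 j0 in nz.
  apply: (@power_reducible_H0 _ _ _ 2 3 _ _ (3 * p 0%N 3%N) (4 * q 2%N 0%N)).
    move=> x y; rewrite Ep Eq !big_ord_recl !big_ord0 /bump /=; split; ring.
  by rewrite !mulf_neq0 ?pnatr_eq0.
(* P = p12 x y^2 + p20 x^2 and Q = q03 y^3 + q11 x y, with X = x, Y = y^2; degree 3 excludes y^4
   from P. *)
- have q03 : q 0%N 3%N != 0.
    case: x0 => j [] nz; first by have := sp _ _ nz; have := dp _ _ nz; lia.
    have j3 : j = 3%N by have := sq _ _ nz; lia.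
    by rewrite j3 in nz.
  have p20 : p 2%N 0%N != 0.
    case: y0 => i [] nz; last by have := sq _ _ nz; lia.
    have i2 : i = 2%N by have := sp _ _ nz; lia.
    by rewrite i2 in nz.
  apply: (@power_reducible_H2 _ _ _ 0 0 _ _
    0 (p 1%N 2%N) (p 2%N 0%N) (2 * q 0%N 3%N) (2 * q 1%N 1%N) 0).
    move=> x y; rewrite Ep Eq !big_ord_recl !big_ord0 /bump /=; split; ring.
  by right; split=> //; rewrite !mulf_neq0 ?pnatr_eq0.
(* P = p12 x y^2 and Q = q03 y^3 + q10 x, with X = x, Y = y^3. *)
- have q03 : q 0%N 3%N != 0.
    case: x0 => j [] nz; first by have := sp _ _ nz; have := dp _ _ nz; lia.
    have j3 : j = 3%N by have := sq _ _ nz; lia.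
    by rewrite j3 in nz.
  have q10 : q 1%N 0%N != 0.
    case: y0 => i [] nz; first by have := sp _ _ nz; lia.
    have i1 : i = 1%N by have := sq _ _ nz; lia.
    by rewrite i1 in nz.
  have p12 : p 1%N 2%N != 0.
    case: p0 => i [j nz].
    have [i1 j2] : i = 1%N /\ j = 2%N.
      by have := sp _ _ nz; have := dp _ _ nz; lia.
    by rewrite i1 j2 in nz.
  apply: (@power_reducible_H1 _ _ _ 0 2 _ _
    0 (p 1%N 2%N) (3 * q 0%N 3%N) (3 * q 1%N 0%N)).
    move=> x y; rewrite Ep Eq !big_ord_recl !big_ord0 /bump /=; split; ring.
  by apply: Or33; split=> //; rewrite !mulf_neq0 ?pnatr_eq0.
(* P = p12 x y^2 and Q = q03 y^3 + q20 x^2, with X = x^2, Y = y^3. *)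
have q03 : q 0%N 3%N != 0.
  case: x0 => j [] nz; first by have := sp _ _ nz; have := dp _ _ nz; lia.
  have j3 : j = 3%N by have := sq _ _ nz; lia.
  by rewrite j3 in nz.
have q20 : q 2%N 0%N != 0.
  case: y0 => i [] nz; first by have := sp _ _ nz; lia.
  have i2 : i = 2%N by have := sq _ _ nz; lia.
  by rewrite i2 in nz.
have p12 : p 1%N 2%N != 0.
  case: p0 => i [j nz].
  have [i1 j2] : i = 1%N /\ j = 2%N.
    by have := sp _ _ nz; have := dp _ _ nz; lia.
  by rewrite i1 j2 in nz.
apply: (@power_reducible_H1 _ _ _ 0 2 _ _
  0 (2 * p 1%N 2%N) (3 * q 0%N 3%N) (3 * q 2%N 0%N)).
  move=> x y; rewrite Ep Eq !big_ord_recl !big_ord0 /bump /=; split; ring.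
by apply: Or33; split=> //; rewrite !mulf_neq0 ?pnatr_eq0.
Qed.

(** * Assembly of the reduction for cubic systems *)

Lemma field_support_swap (R : realType) (p q : nat -> nat -> R) (u v : nat) :
  field_support (fun i j => q j i) (fun i j => p j i) u v
    = field_support p q v u.
Proof. by rewrite /field_support orbC. Qed.

Theorem theorem9 (R : realType) (P Q : {mpoly R[2]})
    (degPQ : system_degree P Q = 3%N)
    (P_neq0 : P != 0) (Q_neq0 : Q != 0)
    (coprimePQ : no_common_factor P Q)
    (qhPQ : quasi_homogeneous P Q)
    (nhPQ : ~ homogeneous P Q) :
  exists H : R -> R -> Prop,
    (H = @half_plane_y R \/ H = @half_plane_x R) /\
    exists Pt Qt : {mpoly R[2]},
      transforms_on H P Q Pt Qt /\
      [\/ system_H2 Pt Qt, system_H1 Pt Qt | system_H0 Pt Qt].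
Proof.
have [s1 [s2 [d [W cop]]]] := weight_vector_coprime P_neq0 qhPQ.
have szP : (msize P <= 4)%N by rewrite /system_degree in degPQ; lia.
have szQ : (msize Q <= 4)%N by rewrite /system_degree in degPQ; lia.
have dP i j : coef2 P i j != 0 -> (i + j < 4)%N.
  by rewrite ltnNge; apply: contraNN => /(coef2_eq0 szP) ->.
have dQ i j : coef2 Q i j != 0 -> (i + j < 4)%N.
  by rewrite ltnNge; apply: contraNN => /(coef2_eq0 szQ) ->.
have [iP [jP [degP nzP]]] := mpoly2_neq0 P_neq0.
have [iQ [jQ [degQ nzQ]]] := mpoly2_neq0 Q_neq0.
have [u [v [S uv]]] : exists u v,
    field_support (coef2 P) (coef2 Q) u v /\ (u + v = 4)%N.
  have [degP3|degQ3] : (iP + jP = 3 \/ iQ + jQ = 3)%N.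
  - by rewrite /system_degree -degP -degQ in degPQ; lia.
  - by exists iP, jP.+1; rewrite /field_support /= nzP; split=> //; lia.
  - by exists iQ.+1, jQ; rewrite /field_support /= nzQ orbT; split=> //; lia.
have [u' [v' [S' uv']]] : exists u v,
    field_support (coef2 P) (coef2 Q) u v /\ (u + v < 4)%N.
  (* If every point lay on u + v = 4, then (1, 1, 3) would be a weight vector. *)
  apply: contrapT => N; apply: nhPQ; exists 3%N.
  apply/field_supportP; split=> // a b Sab.
  suff : (a + b = 4)%N by lia.
  have : ~ (a + b < 4)%N by move=> lt4; apply: N; exists a, b.
  by case/orP: Sab => /andP[gt0 nz]; [have := dP _ _ nz|have := dQ _ _ nz]; lia.
have minW : minimal_weight_vector P Q s1 s2 d.
  by apply: (coprime_weight_vector_minimal S S') => //; rewrite uv.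
suff [Pt [Qt [k [l [can E]]]]] : power_reducible s1 s2 (ev P) (ev Q).
  have [H [HH HT]] := transforms_on_half_plane minW cop E.
  by exists H; split=> //; exists Pt, Qt.
suff [Pt [Qt [k [l [can E]]]]] :
    power_reducible s1 s2 (biev 4 (coef2 P)) (biev 4 (coef2 Q)).
  exists Pt, Qt, k, l; split=> // x y.
  by rewrite (ev_biev _ _ szP) (ev_biev _ _ szQ).
have X0 := no_common_X0 coprimePQ; have X1 := no_common_X1 coprimePQ.
have /weight_vectorP[s1_gt0 s2_gt0 d_gt0 WP WQ] := W.
have [lt_s|lt_s|eq_s] := ltngtP s2 s1.
- apply: (cubic_power_reducible _ d_gt0) => //; rewrite ?s2_gt0 //.
  + by exists iP, jP.
  + by exists iQ, jQ.
  + by exists u, v.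
  + by exists u', v'.
- apply: power_reducible_swap.
  have -> : (fun x y => biev 4 (coef2 Q) y x) = biev 4 (fun i j => coef2 Q j i).
    by apply/funext => x; apply/funext => y; rewrite biev_swap.
  have -> : (fun x y => biev 4 (coef2 P) y x) = biev 4 (fun i j => coef2 P j i).
    by apply/funext => x; apply/funext => y; rewrite biev_swap.
  apply: (cubic_power_reducible _ d_gt0).
  + by rewrite s1_gt0.
  + by rewrite coprime_sym.
  + by move=> i j /WQ; lia.
  + by move=> i j /WP; lia.
  + by move=> i j /dQ; lia.
  + by move=> i j /dP; lia.
  + by exists jQ, iQ.
  + by exists jP, iP.
  + by exists v, u; rewrite field_support_swap addnC.
  + by exists v', u'; rewrite field_support_swap addnC.
  + by case: X1 => i Hi; exists i; case: Hi; [right|left].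
  + by case: X0 => j Hj; exists j; case: Hj; [right|left].
(* Equal weights would force u + v = u' + v'. *)
have /field_supportP[_ _ _ L] := W.
have := L _ _ S; have := L _ _ S'; rewrite eq_s; nia.
Qed.
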